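(* There is a countable transitive set $\mathcal{U}\in V_{\omega_1}$ such that the true binary membership relation $$E=\{(A,B) : A\in B \text{ and } A\in\mathcal{U}\text{ and } B\in\mathcal{U}\}$$ makes $\mathcal{U}$ a model for RST which is elementarily equivalent to $V_{\omega_1}$ (with its true membership relation).
   Context: All sets are pure sets; the background theory is ZFC. A set $U$ is transitive iff $Y\subseteq U$ for all $Y\in U$; an ordinal is a transitive set all of whose members are transitive; $\alpha<\beta$ means $\alpha,\beta$ are ordinals with $\alpha\in\beta$, and $\alpha+1=\alpha\cup\{\alpha\}$. The hierarchy is $V_\emptyset=\emptyset$, $V_{\alpha+1}=\mathcal{P}(V_\alpha)$ for ordinals $\alpha$, and $V_\beta=\bigcup_{\alpha<\beta}V_\alpha$ for limit ordinals $\beta$; $\omega_1=\{\alpha:\alpha\text{ is a countable ordinal}\}$. Elementary equivalence is with respect to first-order formulas with equality in the language with the single binary predicate $\in$ (the language of RST). RST is the first-order theory with equality in the language with the single binary predicate $\in$ and the following axioms (free variables are read universally) for all choices of distinct variables $t,u,v,w,x,y,z$; $\mathrm{var}(F)$ denotes the set of all variables occurring in $F$: A1 $\forall y\,(y\in u\leftrightarrow y\in v)\to u=v$. A2 $\exists u\,\forall y\,(y\in u\leftrightarrow (y\in x\wedge F))$ for all formulas $F$ with $u,x\notin\mathrm{var}(F)$. A3 $\exists y\,y\in u\to\exists y\,(y\in u\wedge\neg\exists z\,(z\in u\wedge z\in y))$. A4 $\exists u\,(x\in u\wedge y\in u)$. A5 $\exists u\,[\,x\in u\ \wedge\ \forall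 y(y\in u\to\forall z(z\in y\to z\in u))\ \wedge\ \forall y(y\in u\to\exists z(z\in u\wedge\forall v(v\in z\leftrightarrow\forall w(w\in v\to w\in y))))\ \wedge\ \forall y(y\in u\to\forall z(z\in u\to\exists v(v\in u\wedge (y\in v\wedge z\in v)\wedge\forall w(w\in v\to\forall t(t\in w\to t\in v)))))\,]$. A6 $\forall x(x\in u\to\exists w\,w\in x)\to\bigl[\forall x\forall y(x\in u\to(y\in u\to(\exists w(w\in x\wedge w\in y)\to x=y)))\to\exists y\forall x(x\in u\to\exists v((v\in x\wedge v\in y)\wedge\forall w((w\in x\wedge w\in y)\to v=w)))\bigr]$. *)

(* Defs.v *)
From HB Require Import structures.
From mathcomp Require Import all_boot.
From mathcomp Require Import boolp classical_sets functions cardinality.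

Set Implicit Arguments.
Unset Strict Implicit.
Unset Printing Implicit Defensive.

Local Open Scope classical_set_scope.
Local Open Scope quotient_scope.

(** The universe of pure sets is Aczel's type of well-founded trees, quotiented
    by extensional equality.  With excluded middle and choice this is a model of
    second-order ZFC, in which equality of sets is Leibniz equality. *)

Inductive tree : Type := sup (I : Type) of I -> tree.

Fixpoint bisim (s t : tree) : Prop :=
  match s, t with
  | sup _ f, sup _ g =>
    (forall i, exists j, bisim (f i) (g j)) /\
    (forall j, exists i, bisim (f i) (g j))
  end.

HB.instance Definition _ := gen_eqMixin tree.
HB.instance Definition _ := gen_choiceMixin tree.

Lemma bisim_refl s : bisim s s.
Proof. by elim: s => I f IH; split=> i; exists i. Qed.

Lemma bisim_sym s t : bisim s t -> bisim t s.
Proof.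
elim: s t => I f IH [J g] [H1 H2]; split.
  by move=> j; have [i ?] := H2 j; exists i; apply: IH.
by move=> i; have [j ?] := H1 i; exists j; apply: IH.
Qed.

Lemma bisim_trans t s r : bisim s t -> bisim t r -> bisim s r.
Proof.
elim: s t r => I f IH [J g] [K h] [H1 H2] [H3 H4]; split.
  move=> i; have [j ij] := H1 i; have [k jk] := H3 j.
  by exists k; apply: IH ij jk.
move=> k; have [j jk] := H4 k; have [i ij] := H2 j.
by exists i; apply: IH ij jk.
Qed.

Definition bisimb : rel tree := fun s t => `[< bisim s t >].

Lemma bisimb_refl : reflexive bisimb.
Proof. by move=> s; apply/asboolP/bisim_refl. Qed.

Lemma bisimb_sym : symmetric bisimb.
Proof. by move=> s t; apply/asboolP/asboolP; apply: bisim_sym. Qed.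

Lemma bisimb_trans : transitive bisimb.
Proof.
move=> t s r /asboolP st /asboolP tr; apply/asboolP.
exact: bisim_trans st tr.
Qed.

Canonical bisim_equiv := EquivRel bisimb bisimb_refl bisimb_sym bisimb_trans.

Definition pset : Type := {eq_quot bisim_equiv}.

HB.instance Definition _ := Choice.on pset.

Lemma pi_bisim s t : \pi_pset s = \pi_pset t <-> bisim s t.
Proof.
split=> [st|st].
  by apply/asboolP; rewrite -[asbool _]/(bisim_equiv s t) -eqmodE; apply/eqP.
by apply/eqP; rewrite eqmodE; apply/asboolP.
Qed.

Lemma repr_pi s : bisim (repr (\pi_pset s)) s.
Proof. by apply/pi_bisim; rewrite reprK. Qed.

Definition tmem (s t : tree) : Prop :=
  let: sup _ g := t in exists j, bisim s (g j).

Definition inp (x y : pset) : Prop := tmem (repr x) (repr y).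

Declare Scope pset_scope.
Delimit Scope pset_scope with pset.
Local Open Scope pset_scope.

Notation "x ∈ y" := (inp x y) (at level 70, no associativity) : pset_scope.

Definition elts (u : pset) : set pset := [set x | x ∈ u].

(** [compr P] is the set {x | P x} when [small P], and the empty set otherwise.
    Smallness is proved for each use: see [inp_empty], [inp_pow], [inp_succ],
    [inp_V] and [inp_omega1]. *)

Definition small (P : set pset) : Prop := exists u, elts u = P.

Definition compr (P : set pset) : pset :=
  xget (\pi_pset (sup (fun e : Empty_set => match e with end)))
       [set u | elts u = P].

Definition subp (x y : pset) : Prop := forall z, z ∈ x -> z ∈ y.

Definition empty : pset := compr set0.

Definition pow (x : pset) : pset := compr [set y | subp y x].

Definition transitive_set (u : pset) : Prop := forall y, y ∈ u -> subp y u.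

Definition ordinal (a : pset) : Prop :=
  transitive_set a /\ forall b, b ∈ a -> transitive_set b.

Definition succ (a : pset) : pset := compr [set x | x ∈ a \/ x = a].

Definition limit (b : pset) : Prop :=
  [/\ ordinal b, b <> empty & ~ exists2 a, ordinal a & b = succ a].

Definition countable_set (u : pset) : Prop := countable (elts u).

Definition omega1 : pset := compr [set a | ordinal a /\ countable_set a].

Lemma inp_index u : exists (I : Type) (f : I -> pset),
  forall x, x ∈ u <-> exists i, f i = x.
Proof.
rewrite /inp; case E: (repr u) => [I f]; exists I, (\pi_pset \o f) => x /=.
split=> -[i xi]; exists i.
  by rewrite -[RHS]reprK; apply/pi_bisim/bisim_sym.
by apply/pi_bisim; rewrite reprK.
Qed.

Lemma small_sub_range (I : Type) (f : I -> pset) (P : set pset) :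
  (forall x, P x -> exists i, f i = x) -> small P.
Proof.
move=> fP.
pose t := sup (fun i : {i | P (f i)} => repr (f (sval i))).
exists (\pi_pset t); apply/seteqP; split=> x; rewrite /elts /= /inp.
  have := repr_pi t; case: (repr (\pi_pset t)) => [J g] [H _] [j xj].
  have [[i Pi] /= ji] := H j.
  suff -> : x = f i by [].
  rewrite -[x]reprK -[f i]reprK; apply/pi_bisim.
  exact: bisim_trans xj ji.
move=> Px; have [i fi] := fP x Px.
have := bisim_sym (repr_pi t); case: (repr (\pi_pset t)) => [J g] [H _].
have Pi : P (f i) by rewrite fi.
have [j /= ij] := H (exist (fun i => P (f i)) i Pi).
by exists j; rewrite -fi.
Qed.

Lemma pset_ext u v : (forall x, x ∈ u <-> x ∈ v) -> u = v.
Proof.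
rewrite /inp => uv; rewrite -[u]reprK -[v]reprK; apply/pi_bisim.
case: (repr u) (repr v) uv => [I f] [J g] uv.
split.
  move=> i; have [|j ij] := (uv (\pi_pset (f i))).1; first by exists i; apply: repr_pi.
  by exists j; apply: bisim_trans ij; apply/bisim_sym/repr_pi.
move=> j; have [|i ij] := (uv (\pi_pset (g j))).2; first by exists j; apply: repr_pi.
by exists i; apply: bisim_trans (bisim_sym ij) (repr_pi _).
Qed.

Lemma comprE (P : set pset) : small P -> forall x, x ∈ compr P <-> P x.
Proof.
rewrite /compr => -[u uP] x; case: xgetP => [v _ /= <-|/(_ u uP)] //.
Qed.

Lemma inp_wf : well_founded inp.
Proof.
suff acc_pi t : Acc inp (\pi_pset t) by move=> x; rewrite -[x]reprK.
elim: t => I f IH; constructor=> y; rewrite /inp.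
have := repr_pi (sup f); case: (repr (\pi_pset (sup f))) => [J g] [H _] [j yj].
have [i ji] := H j.
suff -> : y = \pi_pset (f i) by exact: IH.
rewrite -[LHS]reprK; apply/pi_bisim; exact: bisim_trans yj ji.
Qed.

(** The hierarchy by recursion on membership; [V_empty], [V_succ] and [V_limit]
    are its defining equations on ordinals. *)
Definition Vstep (a : pset) (V : forall b, b ∈ a -> pset) : pset :=
  compr [set x | exists (b : pset) (ba : b ∈ a),
                   (a = succ b /\ subp x (V b ba)) \/
                   (limit a /\ x ∈ V b ba)].

Definition V_ : pset -> pset := Fix inp_wf (fun=> pset) Vstep.

Lemma small_elts u : small (elts u).
Proof. by exists u. Qed.

Lemma small_subset (P Q : set pset) : P `<=` Q -> small Q -> small P.
Proof.
move=> PQ [u uQ]; have [I [f fP]] := inp_index u.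
by apply: (small_sub_range (f := f)) => x /PQ; rewrite -uQ => /fP.
Qed.

Lemma inp_empty x : ~ x ∈ empty.
Proof.
move/comprE; apply.
by apply: (small_sub_range (f := fun e : Empty_set => match e with end)).
Qed.

Lemma inp_pow x y : y ∈ pow x <-> subp y x.
Proof.
apply: comprE; have [I [f fP]] := inp_index x.
pose g (S : I -> Prop) := compr [set z | exists2 i, S i & f i = z].
apply: (small_sub_range (f := g)) => {}y yx.
exists (fun i => f i ∈ y); apply: pset_ext => z.
rewrite comprE; last by apply: (small_sub_range (f := f)) => w [i _ <-]; exists i.
split=> [[i] + <- //|zy]; have [i fi] := (fP z).1 (yx _ zy).
by exists i; rewrite ?fi.
Qed.

Lemma inp_succ a x : x ∈ succ a <-> x ∈ a \/ x = a.
Proof.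
apply: comprE; have [I [f fP]] := inp_index a.
apply: (small_sub_range (f := fun o => if o is Some i then f i else a)) => y.
by case=> [/fP[i fi]|->]; [exists (Some i)|exists None].
Qed.

Lemma small_bigcup (a : pset) (P : pset -> set pset) :
  (forall b, b ∈ a -> small (P b)) -> small [set x | exists2 b, b ∈ a & P b x].
Proof.
move=> sP; have [I [f fP]] := inp_index a.
have fa i : f i ∈ a by apply/fP; exists i.
have /choice[J Jg] i : exists J : Type, exists g : J -> pset,
    forall x, P (f i) x <-> exists j, g j = x.
  have [u uP] := sP _ (fa i); have [J [g gP]] := inp_index u.
  by exists J, g => x; rewrite -gP -uP.
pose g i := sval (cid (Jg i)).
have gP i x : P (f i) x <-> exists j, g i j = x by exact: (svalP (cid (Jg i))).
apply: (small_sub_range (f := fun p : {i & J i} => g _ (projT2 p))) => x.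
by move=> [_ /fP[i <-]] /gP[j <-]; exists (existT _ i j).
Qed.

Lemma inp_V a x : x ∈ V_ a <->
  exists2 b, b ∈ a & (a = succ b /\ subp x (V_ b)) \/ (limit a /\ x ∈ V_ b).
Proof.
rewrite {1}/V_ Fix_eq -/V_ ; last first.
  move=> b f g fg; congr (Vstep _).
  by apply: functional_extensionality_dep => c;
    apply: functional_extensionality_dep => cb; exact: fg.
rewrite /Vstep comprE.
  by split=> [[b [ba H]]|[b ba H]]; exists b => //; exists ba.
apply: (@small_subset _ [set x | exists2 b, b ∈ a &
                            subp x (V_ b) \/ x ∈ V_ b]).
  by move=> y [b [ba [[_ H]|[_ H]]]]; exists b => //; [left|right].
apply: small_bigcup => b _.
have [I [f fP]] := inp_index (V_ b); have [J [g gP]] := inp_index (pow (V_ b)).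
apply: (small_sub_range (f := fun ij => match ij with inl i => f i | inr j => g j end)).
move=> y [/inp_pow/gP[j <-]|/fP[i <-]]; first by exists (inr j).
by exists (inl i).
Qed.

Lemma V_empty : V_ empty = empty.
Proof.
apply: pset_ext => x; rewrite inp_V; split=> [[b /inp_empty//]|/inp_empty//].
Qed.

Lemma inp_irrefl x : ~ x ∈ x.
Proof. by elim/(well_founded_ind inp_wf): x => x IH xx; exact: (IH x xx xx). Qed.

Lemma inp_asym x y : x ∈ y -> ~ y ∈ x.
Proof.
elim/(well_founded_ind inp_wf): x y => x IH y xy yx.
exact: (IH y yx x yx xy).
Qed.

Lemma succ_inj : injective succ.
Proof.
move=> a b ab.
have : a ∈ succ b by rewrite -ab inp_succ; right.
have : b ∈ succ a by rewrite ab inp_succ; right.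
by rewrite !inp_succ => -[ba|//] [/inp_asym//|//].
Qed.

Lemma V_succ a : ordinal a -> V_ (succ a) = pow (V_ a).
Proof.
move=> oa; apply: pset_ext => x; rewrite inp_V inp_pow; split.
  by move=> [b _ [[/succ_inj->]//|[[_ _ []]]]]; exists a.
by move=> xa; exists a; [apply/inp_succ; right|left].
Qed.

Lemma V_limit b x : limit b -> x ∈ V_ b <-> exists2 a, a ∈ b & x ∈ V_ a.
Proof.
move=> lb; rewrite inp_V; split=> -[a ab xa]; exists a => //; last by right.
case: xa => [[bE _]|[]//]; case: (lb) => -[tb ob] _ [].
exists a => //; split=> [|c ca]; first exact: ob.
by apply: ob; apply: tb ca.
Qed.

Lemma inp_omega1 a : a ∈ omega1 <-> ordinal a /\ countable_set a.
Proof.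
apply: comprE.
(* A countable ordinal is determined by the relation that membership induces on
   nat along an injection. *)
pose code (S : nat -> Prop) (R : nat -> nat -> Prop) : set pset := fun b =>
  transitive_set b /\ exists2 g : pset -> nat, {in elts b &, injective g} &
    (forall n, S n <-> exists2 x, x ∈ b & g x = n) /\
    (forall x y, x ∈ b -> y ∈ b -> R (g x) (g y) <-> x ∈ y).
pose c (SR : (nat -> Prop) * (nat -> nat -> Prop)) :=
  xget empty (code SR.1 SR.2).
apply: (small_sub_range (f := c)) => b [[tb ob]] /countable_injP[g gI].
pose S n := exists2 x, x ∈ b & g x = n.
pose R m n := exists x y, [/\ x ∈ b, y ∈ b, g x = m, g y = n & x ∈ y].
exists (S, R); apply: xget_unique => /=.
  split=> //; exists g => //; split=> // x y xb yb; split; last first.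
    by move=> xy; exists x, y.
  move=> [x' [y' [xb' yb' gx gy]]].
  have -> : x' = x by apply: gI; rewrite ?inE.
  by have -> : y' = y by apply: gI; rewrite ?inE.
move=> d [td [h hI [hS hR]]].
have gh x y : x ∈ b -> y ∈ d -> g x = h y -> x = y.
  elim/(well_founded_ind inp_wf): x y => x IH y xb yd gxhy.
  apply: pset_ext => z; split=> [zx|zy].
    have zb : z ∈ b by apply: tb zx.
    have [w wd hw] : exists2 w, w ∈ d & h w = g z by apply/hS; exists z.
    have -> : z = w by apply: IH.
    by apply/hR => //; rewrite hw -gxhy; exists z, x.
  have zd : z ∈ d by apply: td zy.
  have [w wb gw] : S (h z) by apply/hS; exists z.
  have wx : w ∈ x.
    have [] := (hR z y zd yd).2 zy.
    move=> p [q [pb qb gp gq pq]].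
    have <- : p = w by apply: gI; rewrite ?inE ?gp.
    by have <- : q = x by apply: gI; rewrite ?inE ?gq.
  by have <- : w = z by apply: IH.
apply: pset_ext => x; split=> [xd|xb].
  have [w wb gw] : S (h x) by apply/hS; exists x.
  by rewrite -(gh w x).
have [w wd hw] : exists2 w, w ∈ d & h w = g x by apply/hS; exists x.
by rewrite (gh x w).
Qed.

Inductive form : Type :=
| Mem of nat & nat
| Eq of nat & nat
| Neg of form
| Imp of form & form
| And of form & form
| Or of form & form
| Iff of form & form
| All of nat & form
| Ex of nat & form.

Declare Scope fo_scope.
Delimit Scope fo_scope with fo.
Bind Scope fo_scope with form.

Notation "x ∈ y" := (Mem x y) (at level 70, no associativity) : fo_scope.
Notation "x ≐ y" := (Eq x y) (at level 70, no associativity) : fo_scope.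
Notation "¬ F" := (Neg F) (at level 75, right associativity) : fo_scope.
Notation "F ⟶ G" := (Imp F G) (at level 99, right associativity) : fo_scope.
Notation "F ∧ G" := (And F G) (at level 80, right associativity) : fo_scope.
Notation "F ∨ G" := (Or F G) (at level 85, right associativity) : fo_scope.
Notation "F ⟷ G" := (Iff F G) (at level 95, no associativity) : fo_scope.
Notation "∀ x , F" := (All x F) (at level 200, F at level 200) : fo_scope.
Notation "∃ x , F" := (Ex x F) (at level 200, F at level 200) : fo_scope.

(* Quantified variables count as occurring, even when the scope does not
   mention them. *)
Fixpoint var (F : form) : seq nat :=
  match F with
  | Mem x y | Eq x y => [:: x; y]
  | Neg G => var G
  | Imp G H | And G H | Or G H | Iff G H => var G ++ var H
  | All x G | Ex x G => x :: var G
  end.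

Fixpoint fv (F : form) : seq nat :=
  match F with
  | Mem x y | Eq x y => [:: x; y]
  | Neg G => fv G
  | Imp G H | And G H | Or G H | Iff G H => fv G ++ fv H
  | All x G | Ex x G => [seq y <- fv G | y != x]
  end.

Definition sentence (F : form) : Prop := fv F = [::].

Record structure : Type := Structure { dom : Type; erel : dom -> dom -> Prop }.

Definition update (D : Type) (e : nat -> D) (x : nat) (d : D) : nat -> D :=
  fun y => if y == x then d else e y.

Fixpoint sat (M : structure) (e : nat -> dom M) (F : form) : Prop :=
  match F with
  | Mem x y => erel (e x) (e y)
  | Eq x y => e x = e y
  | Neg G => ~ sat e G
  | Imp G H => sat e G -> sat e H
  | And G H => sat e G /\ sat e H
  | Or G H => sat e G \/ sat e H
  | Iff G H => sat e G <-> sat e H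
  | All x G => forall d, sat (update e x d) G
  | Ex x G => exists d, sat (update e x d) G
  end.

Definition holds (M : structure) (F : form) : Prop :=
  forall e : nat -> dom M, sat e F.

Definition model_of (T : set form) (M : structure) : Prop :=
  inhabited (dom M) /\ forall F, T F -> holds M F.

Definition elementarily_equivalent (M N : structure) : Prop :=
  forall F, sentence F -> holds M F <-> holds N F.

Definition axiom1 (u v y : nat) : form :=
  ((∀ y, (y ∈ u ⟷ y ∈ v)) ⟶ u ≐ v)%fo.

Definition axiom2 (F : form) (u x y : nat) : form :=
  (∃ u, ∀ y, (y ∈ u ⟷ y ∈ x ∧ F))%fo.

Definition axiom3 (u y z : nat) : form :=
  ((∃ y, y ∈ u) ⟶ ∃ y, (y ∈ u ∧ ¬ (∃ z, (z ∈ u ∧ z ∈ y))))%fo.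

Definition axiom4 (u x y : nat) : form :=
  (∃ u, (x ∈ u ∧ y ∈ u))%fo.

Definition axiom5 (t u v w x y z : nat) : form :=
  (∃ u,
     (x ∈ u
      ∧ (∀ y, (y ∈ u ⟶ ∀ z, (z ∈ y ⟶ z ∈ u)))
      ∧ (∀ y, (y ∈ u ⟶
           ∃ z, (z ∈ u ∧ ∀ v, (v ∈ z ⟷ ∀ w, (w ∈ v ⟶ w ∈ y)))))
      ∧ (∀ y, (y ∈ u ⟶ ∀ z, (z ∈ u ⟶
           ∃ v, (v ∈ u ∧ (y ∈ v ∧ z ∈ v)
                 ∧ ∀ w, (w ∈ v ⟶ ∀ t, (t ∈ w ⟶ t ∈ v))))))))%fo.

Definition axiom6 (u v w x y : nat) : form :=
  ((∀ x, (x ∈ u ⟶ ∃ w, w ∈ x)) ⟶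
   ((∀ x, ∀ y, (x ∈ u ⟶ (y ∈ u ⟶ ((∃ w, (w ∈ x ∧ w ∈ y)) ⟶ x ≐ y)))) ⟶
    ∃ y, ∀ x, (x ∈ u ⟶
      ∃ v, ((v ∈ x ∧ v ∈ y) ∧ ∀ w, ((w ∈ x ∧ w ∈ y) ⟶ v ≐ w)))))%fo.

Inductive RST : set form :=
| RST1 u v y of uniq [:: u; v; y] : RST (axiom1 u v y)
| RST2 F u x y of uniq [:: u; x; y] & u \notin var F & x \notin var F :
    RST (axiom2 F u x y)
| RST3 u y z of uniq [:: u; y; z] : RST (axiom3 u y z)
| RST4 u x y of uniq [:: u; x; y] : RST (axiom4 u x y)
| RST5 t u v w x y z of uniq [:: t; u; v; w; x; y; z] :
    RST (axiom5 t u v w x y z)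
| RST6 u v w x y of uniq [:: u; v; w; x; y] : RST (axiom6 u v w x y).

Definition set_structure (U : pset) (E : set (pset * pset)) : structure :=
  {| dom := {A : pset | A ∈ U}; erel := fun A B => E (sval A, sval B) |}.

Definition membership_on (U : pset) : set (pset * pset) :=
  [set AB | AB.1 ∈ AB.2 /\ AB.1 ∈ U /\ AB.2 ∈ U].

(* Main.v *)
From HB Require Import structures.
From mathcomp Require Import all_boot boolp classical_sets cardinality.
Require Import Defs.

Set Implicit Arguments.
Unset Strict Implicit.
Unset Printing Implicit Defensive.

Local Open Scope pset_scope.

(** The structure V_omega1 is itself a model of RST, and U is the transitive
    collapse of a countable elementary substructure of it; the only point that
    is not immediate is that the collapse falls back inside V_omega1.

    The axioms hold in V_omega1 because a set belongs to it exactly when it is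
    included in some V_b with b a countable ordinal ([inp_V_omega1]).  Hence
    V_omega1 is closed under elements, subsets, power sets and unions, and also
    under arbitrary countable sets of its own elements
    ([V_omega1_countable]), since countably many countable ordinals have a
    countable bound ([omega1_sup]).  Subset closure gives separation and choice
    sets; countable closure gives pairs, and turns the countable chain w,
    pow w, pow (pow w), ..., with w transitive, into one set that witnesses the
    fifth axiom.

    Closing V_omega1 under Skolem functions yields a sequence f of elements whose
    range contains a witness for every existential formula with parameters in
    that range ([skolem_hull]).  Since V_omega1 is extensional, two distinct
    members of the range are separated by a third, so the Mostowski collapse is
    injective on the range and preserves membership in both directions.  Its
    image U is countable and transitive, and the inverse of the collapse is an
    elementary embedding of U into V_omega1 ([tarski_vaught]): U satisfies RST
    and the same sentences as V_omega1.  By induction on membership, every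
    element of a countable transitive set is a countable set of elements of
    V_omega1; so U belongs to V_omega1 ([countable_transitive_V_omega1]). *)

(** * Ordinals and the levels of the hierarchy *)

Lemma ordinal_mem a b : ordinal a -> b ∈ a -> ordinal b.
Proof. by move=> [ta oa] ba; split=> [|c cb]; apply: oa => //; apply: ta cb. Qed.

Lemma ordinal_succ a : ordinal a -> ordinal (succ a).
Proof.
move=> [ta oa]; split=> [y|b] /inp_succ[ya|->] //; last exact: oa.
  by move=> z zy; apply/inp_succ; left; apply: ta zy.
by move=> z za; apply/inp_succ; left.
Qed.

Lemma ordinal_trichotomy a b :
  ordinal a -> ordinal b -> [\/ a ∈ b, a = b | b ∈ a].
Proof.
elim/(well_founded_ind inp_wf): a b => a IHa b oa.
elim/(well_founded_ind inp_wf): b => b IHb ob.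
have [ab|nab] := pselect (a ∈ b); first by constructor 1.
have [ba|nba] := pselect (b ∈ a); first by constructor 3.
constructor 2; apply: pset_ext => x; split=> [xa|xb].
  have [//|xb|bx] := IHa x xa b (ordinal_mem oa xa) ob; exfalso; apply: nba.
    by rewrite -xb.
  by case: oa => ta _; apply: ta xa _ bx.
have [ax|ax|//] := IHb x xb (ordinal_mem ob xb); exfalso; apply: nab.
  by case: ob => tb _; apply: tb xb _ ax.
by rewrite ax.
Qed.

Lemma limit_succ a b : limit a -> b ∈ a -> succ b ∈ a.
Proof.
move=> [oa _ na] ba; have ob := ordinal_mem oa ba.
have [//|ab|] := ordinal_trichotomy (ordinal_succ ob) oa.
  by case: na; exists b.
by move=> /inp_succ[/inp_asym//|ab]; case: (@inp_irrefl b); rewrite -{2}ab.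
Qed.

(** A description of [V_ a] that is uniform in zero, successor and limit ordinals;
    monotonicity and transitivity of the levels can be read off from it.  At a
    limit it needs [succ b] below the limit, hence the comparability of
    ordinals. *)
Lemma V_ordinal a x :
  ordinal a -> x ∈ V_ a <-> exists2 b, b ∈ a & subp x (V_ b).
Proof.
elim/(well_founded_ind inp_wf): a x => a IH x oa; rewrite inp_V; split.
  move=> [b ba [[_ xb]|[_]]]; first by exists b.
  move=> /(IH b ba _ (ordinal_mem oa ba))[c cb xc]; exists c => //.
  by case: oa => ta _; apply: ta cb.
move=> [b ba xb]; have ob := ordinal_mem oa ba.
have [[c oc ac]|nsucc] := pselect (exists2 c, ordinal c & a = succ c).
  have ca : c ∈ a by rewrite ac inp_succ; right.
  exists c => //; left; split=> // y /xb yb.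
  move: (ba); rewrite ac inp_succ => -[bc|<- //].
  move/(IH b ba _ ob): yb => [d db yd]; apply/IH => //.
  by exists d => //; case: oc => tc _; apply: tc db.
have la : limit a by split=> // a0; apply: (@inp_empty b); rewrite -a0.
exists (succ b); first exact: limit_succ.
by right; split=> //; rewrite V_succ // inp_pow.
Qed.

Lemma omega1_ordinal : ordinal omega1.
Proof.
split=> [a /inp_omega1[oa ca] b ba|a /inp_omega1[[]//]].
apply/inp_omega1; split; first exact: ordinal_mem oa ba.
apply: sub_countable ca; apply: subset_card_le => x xb.
by case: oa => ta _; apply: ta xb.
Qed.

Lemma omega1_succ a : a ∈ omega1 -> succ a ∈ omega1.
Proof.
move=> /inp_omega1[oa ca]; apply/inp_omega1; split; first exact: ordinal_succ.
pose F (i : bool) := if i then elts a else [set a]%classic.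
have : countable (\bigcup_(i in [set: bool]) F i)%classic.
  by apply: bigcup_countable => [|[] _] //; exact: countable1.
apply: sub_countable; apply: subset_card_le => x /inp_succ[xa|->].
  by exists true.
by exists false.
Qed.

Lemma inp_V_omega1 x : x ∈ V_ omega1 <-> exists2 b, b ∈ omega1 & subp x (V_ b).
Proof. exact/V_ordinal/omega1_ordinal. Qed.

(** * Small images and countable families *)

Definition union (x : pset) : pset := compr [set z | exists2 y, y ∈ x & z ∈ y].

Lemma inp_union x z : z ∈ union x <-> exists2 y, y ∈ x & z ∈ y.
Proof.
apply: comprE; apply: (@small_bigcup x (fun y => elts y)) => y _.
exact: small_elts.
Qed.

Lemma small_image (x : pset) (g : pset -> pset) :
  small [set z | exists2 y, y ∈ x & g y = z]%classic.
Proof.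
have [I [f fP]] := inp_index x.
apply: (small_sub_range (f := g \o f)) => z [y /fP[i <-] <-].
by exists i.
Qed.

Lemma small_range (I : Type) (f : I -> pset) : small (range f).
Proof. by apply: (small_sub_range (f := f)) => x [i _ <-]; exists i. Qed.

(** The index type lives in the universe of branching types of [tree], one below
    that of [pset]; this is replacement for families indexed by small types. *)
Definition rangep (I : Type) (f : I -> pset) : pset := compr (range f).

Lemma inp_rangep (I : Type) (f : I -> pset) x : x ∈ rangep f <-> exists i, f i = x.
Proof.
rewrite /rangep comprE; last exact: small_range.
by split=> [[i _ <-]|[i <-]]; exists i.
Qed.

Lemma countable_rangep (f : nat -> pset) : countable_set (rangep f).
Proof.
apply: (@sub_countable _ _ _ [set: nat]); last exact: countableP.
apply: card_le_trans (card_image_le f setT); apply: subset_card_le => x.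
by move=> /inp_rangep[i <-]; exists i.
Qed.

(** * Closure properties of V_omega1 *)

(** The union of the successors of the [b y] is an ordinal, and countable as a
    countable union of countable sets. *)
Lemma omega1_sup (a : pset) (b : pset -> pset) : countable_set a ->
  (forall y, y ∈ a -> b y ∈ omega1) ->
  exists2 c, c ∈ omega1 & forall y, y ∈ a -> b y ∈ c.
Proof.
move=> ca bo.
pose P := (\bigcup_(y in elts a) elts (succ (b y)))%classic.
have sP : small P by apply: (@small_bigcup a) => y _; apply: small_elts.
exists (compr P); last first.
  by move=> y ya; apply/(comprE sP); exists y => //; apply/inp_succ; right.
apply/inp_omega1; split.
  split=> [x|x] /(comprE sP)[y ya].
    move=> xb z zx; apply/(comprE sP); exists y => //.
    have /inp_omega1[[ty _] _] := omega1_succ (bo _ ya).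
    exact: ty xb _ zx.
  have /inp_omega1[[_ oy] _] := omega1_succ (bo _ ya).
  exact: oy.
apply: (@sub_countable _ _ _ P); first by apply: subset_card_le => x /(comprE sP).
apply: bigcup_countable => // y ya.
by have /inp_omega1[] := omega1_succ (bo _ ya).
Qed.

Lemma V_omega1_transitive : transitive_set (V_ omega1).
Proof.
move=> x /inp_V_omega1[b bo xb] y /xb yb.
have /inp_omega1[ob _] := bo.
move/(V_ordinal _ ob): yb => [c cb yc]; apply/inp_V_omega1; exists c => //.
by case: omega1_ordinal => t _; apply: t cb.
Qed.

Lemma V_omega1_countable x :
  countable_set x -> subp x (V_ omega1) -> x ∈ V_ omega1.
Proof.
move=> cx xV.
have /choice[b bP] y : exists b, y ∈ x -> b ∈ omega1 /\ subp y (V_ b).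
  have [yx|nyx] := pselect (y ∈ x); last by exists y.
  by have /inp_V_omega1[b bo yb] := xV y yx; exists b.
have [c co bc] : exists2 c, c ∈ omega1 & forall y, y ∈ x -> b y ∈ c.
  by apply: omega1_sup => // y /bP[].
apply/inp_V_omega1; exists c => // y yx; have /inp_omega1[oc _] := co.
by apply/(V_ordinal _ oc); exists (b y); [exact: bc|case: (bP y yx)].
Qed.

Lemma V_omega1_pow x : x ∈ V_ omega1 -> pow x ∈ V_ omega1.
Proof.
move=> /inp_V_omega1[b bo xb]; apply/inp_V_omega1; exists (succ b).
  exact: omega1_succ.
have /inp_omega1[ob _] := bo; rewrite V_succ // => y /inp_pow yx.
by apply/inp_pow => z /yx /xb.
Qed.

Lemma V_omega1_subp x y : x ∈ V_ omega1 -> subp y x -> y ∈ V_ omega1.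
Proof.
move=> xV yx; apply: V_omega1_transitive (V_omega1_pow xV) _ _.
exact/inp_pow.
Qed.

Lemma V_omega1_union x : x ∈ V_ omega1 -> union x ∈ V_ omega1.
Proof.
move=> /inp_V_omega1[b bo xb]; apply/inp_V_omega1; exists b => // z.
have /inp_omega1[ob _] := bo.
move=> /inp_union[y /xb /(V_ordinal _ ob)[c cb yc] /yc].
have oc := ordinal_mem ob cb.
move=> /(V_ordinal _ oc)[d dc zd]; apply/(V_ordinal _ ob); exists d => //.
by case: ob => tb _; apply: tb dc.
Qed.

(** The levels of the hierarchy are transitive and cofinal in V_omega1. *)
Lemma V_omega1_hull x : x ∈ V_ omega1 ->
  exists w, [/\ w ∈ V_ omega1, x ∈ w & transitive_set w].
Proof.
move=> /inp_V_omega1[b bo xb]; exists (V_ (succ b)).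
have /inp_omega1[ob _] := bo; have so := omega1_succ bo.
split; last 2 first.
- by rewrite V_succ // inp_pow.
- rewrite V_succ // => y /inp_pow yb z /yb /(V_ordinal _ ob)[c cb zc].
  apply/inp_pow => t /zc tc; apply/(V_ordinal _ ob).
  have /V_ordinal : ordinal c by exact: ordinal_mem ob cb.
  move=> /(_ t)[] /(_ tc)[d dc td] _; exists d => //.
  by case: ob => tb _; apply: tb dc.
by apply/inp_V_omega1; exists (succ b).
Qed.

(** By induction on membership, all elements of [u] are in V_omega1: each of
    them is a subset of [u], hence countable. *)
Lemma countable_transitive_V_omega1 u :
  countable_set u -> transitive_set u -> u ∈ V_ omega1.
Proof.
move=> cu tu; apply: V_omega1_countable => //.
move=> y; elim/(well_founded_ind inp_wf): y => y IH yu.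
apply: V_omega1_countable => [|z zy].
  by apply: sub_countable cu; apply: subset_card_le => z; apply: tu yu z.
by apply: IH => //; apply: tu yu z zy.
Qed.

(** * Skolem hulls and elementary embeddings *)

Lemma sat_fv (M : structure) F (e e' : nat -> dom M) :
  {in fv F, e =1 e'} -> sat e F <-> sat e' F.
Proof.
elim: F e e' => [x y|x y|G IH|G IHG H IHH|G IHG H IHH|G IHG H IHH|G IHG H IHH
  |x G IH|x G IH] e e' ee' /=.
1,2: by rewrite !ee' ?inE ?eqxx ?orbT.
2-5: rewrite (IHG e e') ?(IHH e e') // => i iF;
  by apply: ee'; rewrite mem_cat iF ?orbT.
- by rewrite (IH e e').
- suff E d : sat (update e x d) G <-> sat (update e' x d) G by split=> H d; apply/E.
  apply: IH => i iG; rewrite /update; case: eqVneq => // ix.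
  by apply: ee'; rewrite mem_filter ix.
- suff E d : sat (update e x d) G <-> sat (update e' x d) G.
    by split=> -[d H]; exists d; apply/E.
  apply: IH => i iG; rewrite /update; case: eqVneq => // ix.
  by apply: ee'; rewrite mem_filter ix.
Qed.

Lemma fv_var F : {subset fv F <= var F}.
Proof.
elim: F => [x y|x y|//|G IHG H IHH|G IHG H IHH|G IHG H IHH|G IHG H IHH|x G IH
  |x G IH] i //=; rewrite ?mem_cat ?mem_filter ?inE.
1-4: by case/orP => [/IHG|/IHH] ->; rewrite ?orbT.
1,2: by case/andP => _ /IH ->; rewrite orbT.
Qed.

(** There are countably many formulas: this is what keeps the Skolem hull
    countable. *)
Fixpoint form_code (F : form) : GenTree.tree nat :=
  match F with
  | Mem x y => GenTree.Node 0 [:: GenTree.Leaf x; GenTree.Leaf y]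
  | Eq x y => GenTree.Node 1 [:: GenTree.Leaf x; GenTree.Leaf y]
  | Neg G => GenTree.Node 2 [:: form_code G]
  | Imp G H => GenTree.Node 3 [:: form_code G; form_code H]
  | And G H => GenTree.Node 4 [:: form_code G; form_code H]
  | Or G H => GenTree.Node 5 [:: form_code G; form_code H]
  | Iff G H => GenTree.Node 6 [:: form_code G; form_code H]
  | All x G => GenTree.Node 7 [:: GenTree.Leaf x; form_code G]
  | Ex x G => GenTree.Node 8 [:: GenTree.Leaf x; form_code G]
  end.

Fixpoint form_decode (t : GenTree.tree nat) : option form :=
  match t with
  | GenTree.Node 0 [:: GenTree.Leaf x; GenTree.Leaf y] => Some (Mem x y)
  | GenTree.Node 1 [:: GenTree.Leaf x; GenTree.Leaf y] => Some (Eq x y)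
  | GenTree.Node 2 [:: g] => omap Neg (form_decode g)
  | GenTree.Node 7 [:: GenTree.Leaf x; g] => omap (All x) (form_decode g)
  | GenTree.Node 8 [:: GenTree.Leaf x; g] => omap (Ex x) (form_decode g)
  | GenTree.Node n [:: g; h] =>
    if (form_decode g, form_decode h) is (Some G, Some H) then
      match n with
      | 3 => Some (Imp G H) | 4 => Some (And G H)
      | 5 => Some (Or G H) | 6 => Some (Iff G H)
      | _ => None
      end
    else None
  | _ => None
  end.

Lemma form_codeK : pcancel form_code form_decode.
Proof.
by elim=> //= [G ->|G -> H ->|G -> H ->|G -> H ->|G -> H ->|x G ->|x G ->].
Qed.

HB.instance Definition _ := Countable.copy form (pcan_type form_codeK).

(** A node labelled [n] stands for the [n]-th Skolem function applied to the
    values of its children, a leaf for the base point [d0].  Encoding terms as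
    trees labelled by numbers makes them countable at once. *)
Fixpoint skolem_term (D : Type) (d0 : D) (sk : nat -> seq D -> D)
    (t : GenTree.tree nat) : D :=
  match t with
  | GenTree.Leaf _ => d0
  | GenTree.Node n ts => sk n [seq skolem_term d0 sk t | t <- ts]
  end.

(** Downward Loewenheim-Skolem: the range of [f] is a countable subset that
    contains witnesses for all existential formulas with parameters in it.  The
    values of all Skolem terms form such a set, because a formula reads only
    finitely many of its parameters and so its witness is the value of one term. *)
Lemma skolem_hull (N : structure) : inhabited (dom N) ->
  exists f : nat -> dom N,
    forall F x (e : nat -> nat), sat (f \o e) (Ex x F) ->
      exists c, sat (update (f \o e) x (f c)) F.
Proof.
move=> [d0].
have /choice[w wP] (p : nat * form * seq (dom N)) : exists d,
    (exists d, sat (update (nth d0 p.2) p.1.1 d) p.1.2) ->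
    sat (update (nth d0 p.2) p.1.1 d) p.1.2.
  have [[d dP]|nP] := pselect (exists d, sat (update (nth d0 p.2) p.1.1 d) p.1.2).
    by exists d.
  by exists d0.
pose sk n s := if unpickle n is Some p then w (p, s) else d0.
(* Numbers that code no term fall back on a leaf, that is on [d0]. *)
pose term n : GenTree.tree nat := odflt (GenTree.Leaf 0) (unpickle n).
exists (skolem_term d0 sk \o term) => F x e /= [d dF].
have [n fv_lt] : exists n, forall i, i \in fv F -> i < n.
  by exists (\max_(i <- fv F) i).+1 => i iF; rewrite ltnS (big_rem i) //= leq_maxl.
pose s := [seq term (e i) | i <- iota 0 n].
(* The children of the node list the parameters of variables 0 to n - 1. *)
exists (pickle (GenTree.Node (pickle (x, F)) s)).
rewrite /= {2}/term pickleK /= {2}/sk pickleK; set s' := map _ s.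
have agree c : sat (update (skolem_term d0 sk \o term \o e) x c) F <->
               sat (update (nth d0 s') x c) F.
  apply: sat_fv => i iF; rewrite /update; case: eqP => // _.
  have lt_in := fv_lt i iF.
  rewrite /s' /s -map_comp (nth_map 0) ?size_iota //.
  by rewrite nth_iota.
by apply/agree/(wP (x, F, s')); exists d; apply/agree.
Qed.

(** Only witnesses for existential formulas have to be pulled back: a
    counterexample to a universal one is a witness for its negation. *)
Lemma tarski_vaught (M N : structure) (h : dom M -> dom N) :
  injective h ->
  (forall a b, erel a b <-> erel (h a) (h b)) ->
  (forall F x (e : nat -> dom M), sat (h \o e) (Ex x F) ->
     exists c, sat (update (h \o e) x (h c)) F) ->
  forall F (e : nat -> dom M), sat e F <-> sat (h \o e) F.
Proof.
move=> hI hE hT.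
have hu (e : nat -> dom M) x c : update (h \o e) x (h c) = h \o update e x c.
  by apply/funext => i; rewrite /update /=; case: eqP.
elim=> [x y|x y|G IH|G IHG H IHH|G IHG H IHH|G IHG H IHH|G IHG H IHH|x G IH
  |x G IH] e /=.
- exact: hE.
- by split=> [->|/hI].
- by rewrite IH.
- by rewrite IHG IHH.
- by rewrite IHG IHH.
- by rewrite IHG IHH.
- by rewrite IHG IHH.
- split=> [sG d|sG d]; last by apply/IH; rewrite -hu.
  apply: contrapT => nG.
  have [|c /=] := hT (Neg G) x e; first by exists d.
  by apply; rewrite hu -IH.
- split=> [[d sG]|sG]; first by exists (h d); rewrite hu -IH.
  by have [c] := hT G x e sG; rewrite hu -IH; exists c.
Qed.

Lemma holds_elementary (M N : structure) (h : dom M -> dom N) :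
  (forall F (e : nat -> dom M), sat e F <-> sat (h \o e) F) ->
  forall F, holds N F -> holds M F.
Proof. by move=> hF F NF e; apply/hF. Qed.

(** Truth of a sentence is independent of the assignment, so one assignment that
    factors through [h] decides it. *)
Lemma elementary_embedding_equivalent (M N : structure) (h : dom M -> dom N) :
  inhabited (dom M) ->
  (forall F (e : nat -> dom M), sat e F <-> sat (h \o e) F) ->
  elementarily_equivalent M N.
Proof.
move=> [m] hF F sF; split=> [MF e|]; last exact: holds_elementary.
have /hF := MF (fun=> m).
by apply: iffLR; apply: sat_fv => i; rewrite sF.
Qed.

(** * The Mostowski collapse of an extensional class *)

Section Collapse.
Variable X : set pset.

Definition collapse_step (x : pset) (p : forall y, y ∈ x -> pset) : pset :=
  compr [set z | exists (y : pset) (yx : y ∈ x), X y /\ p y yx = z]%classic.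

Definition collapse : pset -> pset := Fix inp_wf (fun=> pset) collapse_step.

Lemma inp_collapse x z :
  z ∈ collapse x <-> exists y, [/\ y ∈ x, X y & collapse y = z].
Proof.
rewrite {1}/collapse Fix_eq -/collapse; last first.
  move=> y f g fg; congr (collapse_step _).
  by apply: functional_extensionality_dep => c;
    apply: functional_extensionality_dep => cy; exact: fg.
rewrite /collapse_step comprE.
  by split=> [[y [yx [Xy <-]]]|[y [yx Xy <-]]]; exists y.
apply: small_subset (small_image x collapse) => w [y [yx [_ yw]]].
by exists y.
Qed.

Hypothesis X_ext : forall x y, X x -> X y ->
  (forall z, X z -> z ∈ x <-> z ∈ y) -> x = y.

(** By induction on membership, [x] and [y] have the same elements in [X]: the
    collapse of an element of one is the collapse of some element of the other,
    and the induction hypothesis identifies the two. *)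
Lemma collapse_inj x y : X x -> X y -> collapse x = collapse y -> x = y.
Proof.
elim/(well_founded_ind inp_wf): x y => x IH y Xx Xy xy.
apply: X_ext => // z Xz; split=> [zx|zy].
  have : collapse z ∈ collapse y by rewrite -xy; apply/inp_collapse; exists z.
  by move=> /inp_collapse[w [wy Xw wz]]; rewrite (IH z zx w).
have : collapse z ∈ collapse x by rewrite xy; apply/inp_collapse; exists z.
by move=> /inp_collapse[w [wx Xw wz]]; rewrite -(IH w wx z).
Qed.

Lemma collapse_mem x y : X x -> X y -> collapse x ∈ collapse y <-> x ∈ y.
Proof.
move=> Xx Xy; split=> [/inp_collapse[z [zy Xz /collapse_inj <-//]]|xy].
by apply/inp_collapse; exists x.
Qed.

End Collapse.

(** * V_omega1 is a model of RST *)

(** With [inp] itself as the relation, satisfaction of a concrete formula computes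
    to a statement about membership. *)
Definition mem_structure (U : pset) : structure :=
  {| dom := {A : pset | A ∈ U}; erel := fun A B => sval A ∈ sval B |}.

Lemma membership_onE U : set_structure U (membership_on U) = mem_structure U.
Proof.
congr Structure; apply/funext => A; apply/funext => B; apply/propext.
rewrite /membership_on /=.
by split=> [[]//|AB]; split=> //; split; [case: A AB|case: B AB].
Qed.

Lemma sval_eq (T : Type) (P : T -> Prop) (a b : {x | P x}) :
  sval a = sval b -> a = b.
Proof. by case: a b => [a Pa] [b Pb] /= ab; apply: eq_exist. Qed.

Notation Vomega1 := (mem_structure (V_ omega1)).

Definition in_Vomega1 (x : pset) (xV : x ∈ V_ omega1) : dom Vomega1 :=
  exist (fun x => x ∈ V_ omega1) x xV.

Lemma in_Vomega1P (x : dom Vomega1) : sval x ∈ V_ omega1.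
Proof. by case: x. Qed.

Lemma mem_in_Vomega1 (x : dom Vomega1) y : y ∈ sval x -> y ∈ V_ omega1.
Proof. exact/V_omega1_transitive/in_Vomega1P. Qed.

(** Computes the values of all variables of a concrete formula, given that these
    variables are pairwise distinct. *)
Ltac eval_update :=
  rewrite /= /update ?eqxx;
  repeat match goal with H : is_true (?a != ?b) |- _ =>
    rewrite ?[b == a]eq_sym ?(negbTE H); clear H end.

Lemma Vomega1_extensionality u v y :
  uniq [:: u; v; y] -> holds Vomega1 (axiom1 u v y).
Proof.
rewrite /= !inE !negb_or -!andbA => /and4P[uv uy vy _] e; eval_update => uvE.
apply/sval_eq/pset_ext => z; split=> zM.
  exact: (uvE (in_Vomega1 (mem_in_Vomega1 zM))).1 zM.
exact: (uvE (in_Vomega1 (mem_in_Vomega1 zM))).2 zM.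
Qed.

(** The witness is the subset of [e x] cut out by [F] under the assignment [e]; as
    [u] does not occur in [F], assigning this witness to [u] does not change what
    [F] says. *)
Lemma Vomega1_separation F u x y : uniq [:: u; x; y] -> u \notin var F ->
  holds Vomega1 (axiom2 F u x y).
Proof.
rewrite /= !inE !negb_or -!andbA => /and4P[ux uy xy _] uF e.
pose P := [set z | z ∈ sval (e x) /\ exists zV,
  @sat Vomega1 (update e y (@in_Vomega1 z zV)) F]%classic.
have sP : small P.
  by apply: small_subset (small_elts (sval (e x))) => z [].
have PV : compr P ∈ V_ omega1.
  by apply: V_omega1_subp (in_Vomega1P (e x)) _ => z /(comprE sP)[].
exists (in_Vomega1 PV) => z.
pose e' := update (update e u (in_Vomega1 PV)) y z.
have [ey eu ex] : [/\ e' y = z, e' u = in_Vomega1 PV & e' x = e x].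
  by rewrite /e'; split; eval_update.
have FE : @sat Vomega1 e' F <-> @sat Vomega1 (update e y z) F.
  apply: sat_fv => i /fv_var iF; rewrite /e' /update; case: eqP => // _.
  by case: eqP => // iu; rewrite -iu iF in uF.
(* Unfolds satisfaction at the top of the formula and stops at [F]. *)
change (sval (e' y) ∈ sval (e' u) <->
        sval (e' y) ∈ sval (e' x) /\ @sat Vomega1 e' F).
rewrite ey eu ex FE /= comprE //; split=> [[zx [zV zF]]|[zx zF]].
  by split=> //; rewrite (_ : z = in_Vomega1 zV) //; apply: sval_eq.
split=> //; exists (in_Vomega1P z).
by rewrite (_ : in_Vomega1 _ = z) //; apply: sval_eq.
Qed.

Lemma Vomega1_foundation u y z : uniq [:: u; y; z] -> holds Vomega1 (axiom3 u y z).
Proof.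
rewrite /= !inE !negb_or -!andbA => /and4P[uy uz yz _] e; eval_update.
move=> [[x xV] /=]; elim/(well_founded_ind inp_wf): x xV => x IH xV xu.
have [[w wu wx]|nw] := pselect (exists2 w, w ∈ sval (e u) & w ∈ x).
  exact: (IH w wx (mem_in_Vomega1 wu) wu).
by exists (in_Vomega1 xV); split=> // -[w [wu wx]]; apply: nw; exists (sval w).
Qed.

Lemma Vomega1_pairing u x y : uniq [:: u; x; y] -> holds Vomega1 (axiom4 u x y).
Proof.
rewrite /= !inE !negb_or -!andbA => /and4P[ux uy xy _] e; eval_update.
pose p n := if n is 0 then sval (e x) else sval (e y).
have pV : rangep p ∈ V_ omega1.
  apply: V_omega1_countable; first exact: countable_rangep.
  by move=> z /inp_rangep[[|n] <-]; apply: in_Vomega1P.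
exists (in_Vomega1 pV); rewrite /= !inp_rangep.
by split; [exists 0|exists 1].
Qed.

(** The witness is the union [s] of the chain of iterated power sets of a
    transitive set around [x].  Each stage is a transitive element and a subset
    of the next one, which gives a transitive set around any two elements of [s];
    the power set of an element of one stage appears two stages later. *)
Lemma Vomega1_closed_hull t u v w x y z : uniq [:: t; u; v; w; x; y; z] ->
  holds Vomega1 (axiom5 t u v w x y z).
Proof.
rewrite /= !inE !negb_or -!andbA => H e; do 21! [case/andP: H => ? H]; clear H.
eval_update.
have [w0 [w0V xw0 tw0]] := V_omega1_hull (in_Vomega1P (e x)).
pose W n := iter n pow w0.
have WV n : W n ∈ V_ omega1 by elim: n => //= n; apply: V_omega1_pow.
have tW n : transitive_set (W n).
  elim: n => //= n IH a /inp_pow an b /an bn; apply/inp_pow; exact: IH.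
have WS n : subp (W n) (W n.+1) by move=> a an; apply/inp_pow/tW.
have Wle m n : m <= n -> subp (W m) (W n).
  move=> /subnK <-; elim: (n - m) => //= k IH a /IH; exact: WS.
pose s := union (rangep W).
have inS a : a ∈ s <-> exists n, a ∈ W n.
  rewrite inp_union; split=> [[_ /inp_rangep[n <-] an]|[n an]]; first by exists n.
  by exists (W n) => //; apply/inp_rangep; exists n.
have sV : s ∈ V_ omega1.
  apply/V_omega1_union/V_omega1_countable; first exact: countable_rangep.
  by move=> a /inp_rangep[n <-].
exists (in_Vomega1 sV); rewrite /=; split; first by apply/inS; exists 0.
split=> [a /inS[n an] b ba|]; first by apply/inS; exists n; apply: tW an _ ba.
split=> [a /inS[n an]|a /inS[m am] b /inS[n bn]].
  exists (in_Vomega1 (V_omega1_pow (in_Vomega1P a))); split=> /=.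
    apply/inS; exists n.+2; apply/inp_pow => b /inp_pow ba.
    by apply/inp_pow => c /ba; apply: tW an c.
  move=> b; rewrite inp_pow; split=> [ba c|ba c cb]; first exact: ba.
  exact: (ba (in_Vomega1 (mem_in_Vomega1 cb))).
pose k := maxn m n; exists (in_Vomega1 (WV k)); split=> /=.
  by apply/inS; exists k.+1; apply/inp_pow.
split=> [|c ck d dc]; last exact: tW ck _ dc.
by split; [apply: Wle am|apply: Wle bn]; rewrite ?leq_maxl ?leq_maxr.
Qed.

(** The values of a choice function form a subset of the union of [u], hence an
    element of V_omega1; disjointness makes them unique. *)
Lemma Vomega1_choice_set u v w x y : uniq [:: u; v; w; x; y] ->
  holds Vomega1 (axiom6 u v w x y).
Proof.
rewrite /= !inE !negb_or -!andbA => H e; do 10! [case/andP: H => ? H]; clear H.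
eval_update => u_ne u_disj.
have /choice[c cP] a : exists b, a ∈ sval (e u) -> b ∈ a.
  have [au|nau] := pselect (a ∈ sval (e u)); last by exists a.
  by have [b ba] := u_ne (in_Vomega1 (mem_in_Vomega1 au)) au; exists (sval b).
pose s := compr [set z | exists2 a, a ∈ sval (e u) & c a = z]%classic.
have inS b : b ∈ s <-> exists2 a, a ∈ sval (e u) & c a = b.
  exact/comprE/small_image.
have sV : s ∈ V_ omega1.
  apply: V_omega1_subp (V_omega1_union (in_Vomega1P (e u))) _ => b /inS[a au <-].
  by apply/inp_union; exists a => //; apply: cP.
exists (in_Vomega1 sV) => a au; have ca := cP _ au.
exists (in_Vomega1 (mem_in_Vomega1 ca)) => /=; split.
  by split=> //; apply/inS; exists (sval a).
move=> b [ba /inS[d du db]]; apply: sval_eq => /=; rewrite -db.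
have <- // : in_Vomega1 (mem_in_Vomega1 du) = a.
apply: u_disj => //; exists b; split=> //=; rewrite -db; exact: cP.
Qed.

Lemma Vomega1_RST : model_of RST Vomega1.
Proof.
have eV : empty ∈ V_ omega1.
  apply: V_omega1_countable => [|x /inp_empty//].
  apply: (sub_countable _ (@countable0 pset)).
  by apply: subset_card_le => x /inp_empty.
split; first by exists; exact: in_Vomega1 eV.
move=> _ [u v y|F u x y + + _|u y z|u x y|t u v w x y z|u v w x y].
- exact: Vomega1_extensionality.
- exact: Vomega1_separation.
- exact: Vomega1_foundation.
- exact: Vomega1_pairing.
- exact: Vomega1_closed_hull.
- exact: Vomega1_choice_set.
Qed.

(** * The countable transitive model *)

Theorem theorem5p6 :
  exists U : pset,
    [/\ countable_set U,
        transitive_set U,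
        U ∈ V_ omega1,
        model_of RST (set_structure U (membership_on U))
      & elementarily_equivalent
          (set_structure U (membership_on U))
          (set_structure (V_ omega1) (membership_on (V_ omega1)))].
Proof.
have [Vomega1_inh Vomega1_axioms] := Vomega1_RST.
have [f f_witness] := skolem_hull Vomega1_inh.
pose X := range (sval \o f).
have X_ext a b : X a -> X b -> (forall z, X z -> z ∈ a <-> z ∈ b) -> a = b.
  move=> [i _ <-] [j _ <-] ij; apply: contrapT => nij.
  (* [X] contains a witness for the formula that variables 0 and 1 differ on
     the membership of variable 2. *)
  pose F := Neg (Iff (Mem 2 0) (Mem 2 1)).
  have [|k /=] := f_witness F 2 (fun n => if n is 0 then i else j).
    apply: contrapT => nk; apply: nij; apply: pset_ext => z.
    split=> zM; apply: contrapT => nz; apply: nk.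
      by exists (in_Vomega1 (mem_in_Vomega1 zM)) => -[/(_ zM)].
    by exists (in_Vomega1 (mem_in_Vomega1 zM)) => -[_ /(_ zM)].
  by apply; apply: ij; exists k.
pose p n := collapse X (sval (f n)).
have Xf n : X (sval (f n)) by exists n.
pose U := rangep p.
have cU : countable_set U by exact: countable_rangep.
have tU : transitive_set U.
  move=> _ /inp_rangep[n <-] z /inp_collapse[_ [_ [m _ <-] <-]].
  by apply/inp_rangep; exists m.
have /choice[idx idxP] (a : dom (mem_structure U)) : exists n, p n = sval a.
  by apply/inp_rangep; case: a.
(* The inverse of the collapse. *)
pose h a := f (idx a).
have h_inj : injective h.
  by move=> a b ab; apply: sval_eq; rewrite -!idxP /p -/(h a) ab.
have h_elem F (e : nat -> dom (mem_structure U)) : sat e F <-> sat (h \o e) F.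
  apply: tarski_vaught => // [a b|{e}G x e /f_witness[k kP]].
    by rewrite /= -!idxP; apply: collapse_mem.
  have pk : p k ∈ U by apply/inp_rangep; exists k.
  exists (exist (fun x => x ∈ U) (p k) pk).
  suff -> : h (exist (fun x => x ∈ U) (p k) pk) = f k by [].
  exact/sval_eq/(collapse_inj X_ext (Xf _) (Xf _))/(idxP (exist _ (p k) pk)).
have U_inh : inhabited (dom (mem_structure U)).
  by exists; exists (p 0); apply/inp_rangep; exists 0.
exists U; rewrite !membership_onE; split=> //.
- exact: countable_transitive_V_omega1.
- by split=> // F /Vomega1_axioms; apply: holds_elementary h_elem F.
- exact: elementary_embedding_equivalent U_inh h_elem.
Qed.
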